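(* Let $k$ be a positive integer and let $G$ be a graph. If $G$ is proportionally $k$-choosable, then $G$ is both equitably $k$-choosable and equitably $k$-colorable.
   Context: All graphs are finite and simple. For a positive integer $k$, a $k$-assignment $L$ for a graph $G$ assigns to each vertex $v$ a set $L(v)$ of exactly $k$ colors; its palette is $\mathcal{L} = \bigcup_{v \in V(G)} L(v)$, and for $c \in \mathcal{L}$, $\eta(c) = |\{v \in V(G) : c \in L(v)\}|$. A proper $L$-coloring of $G$ is a proper coloring $f$ of $G$ with $f(v) \in L(v)$ for every vertex $v$. It is a proportional $L$-coloring if for every $c \in \mathcal{L}$, $|f^{-1}(c)|$ equals $\lfloor \eta(c)/k \rfloor$ or $\lceil \eta(c)/k \rceil$; $G$ is proportionally $k$-choosable if a proportional $L$-coloring of $G$ exists for every $k$-assignment $L$ for $G$. A proper $L$-coloring (for a $k$-assignment $L$) is equitable if each color appears on at most $\lceil |V(G)|/k \rceil$ vertices; $G$ is equitably $k$-choosable if an equitable $L$-coloring of $G$ exists for every $k$-assignment $L$ for $G$. An equitable $k$-coloring of $G$ is a proper coloring with exactly $k$ (possibly empty) color classes whose sizes pairwise differ by at most one; $G$ is equitably $k$-colorable if it has an equitable $k$-coloring. *)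

(* Defs.v *)
From mathcomp Require Import all_boot.

Set Implicit Arguments.
Unset Strict Implicit.
Unset Printing Implicit Defensive.

(* Finite simple graphs; the empty graph is allowed. *)
Record sgraph := SGraph {
  vertex :> finType;
  adj : rel vertex;
  adj_sym : symmetric adj;
  adj_irr : irreflexive adj
}.

(* The ceiling of m / d, for 0 < d. *)
Definition ceil_div (m d : nat) : nat := m %/ d + ~~ (d %| m).

Definition proper_coloring (G : sgraph) (C : finType) (f : G -> C) : Prop :=
  forall u v : G, adj u v -> f u != f v.

Definition color_class (G : sgraph) (C : finType) (f : G -> C) (c : C)
    : {set G} :=
  [set v | f v == c].

(* Since G is finite, the colors used by a list assignment form a finite set,
   so lists are subsets of a finite type C; the choosability notions below
   quantify over all such C. Elements of C that lie in no list are permitted. *)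
Definition k_assignment (k : nat) (G : sgraph) (C : finType)
    (L : G -> {set C}) : Prop :=
  forall v : G, #|L v| = k.

Definition palette (G : sgraph) (C : finType) (L : G -> {set C}) : {set C} :=
  \bigcup_(v : G) L v.

Definition eta_mult (G : sgraph) (C : finType) (L : G -> {set C}) (c : C)
    : nat :=
  #|[set v : G | c \in L v]|.

Definition proper_L_coloring (G : sgraph) (C : finType) (L : G -> {set C})
    (f : G -> C) : Prop :=
  proper_coloring f /\ forall v : G, f v \in L v.

Definition proportional_L_coloring (k : nat) (G : sgraph) (C : finType)
    (L : G -> {set C}) (f : G -> C) : Prop :=
  proper_L_coloring L f /\
  forall c : C, c \in palette L ->
    #|color_class f c| = eta_mult L c %/ k \/
    #|color_class f c| = ceil_div (eta_mult L c) k.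

Definition proportionally_choosable (k : nat) (G : sgraph) : Prop :=
  forall (C : finType) (L : G -> {set C}), k_assignment k L ->
    exists f : G -> C, proportional_L_coloring k L f.

Definition equitable_L_coloring (k : nat) (G : sgraph) (C : finType)
    (L : G -> {set C}) (f : G -> C) : Prop :=
  proper_L_coloring L f /\
  forall c : C, #|color_class f c| <= ceil_div #|G| k.

Definition equitably_choosable (k : nat) (G : sgraph) : Prop :=
  forall (C : finType) (L : G -> {set C}), k_assignment k L ->
    exists f : G -> C, equitable_L_coloring k L f.

Definition equitable_coloring (k : nat) (G : sgraph) (f : G -> 'I_k) : Prop :=
  proper_coloring f /\
  forall i j : 'I_k, #|color_class f i| <= #|color_class f j| + 1.

Definition equitably_colorable (k : nat) (G : sgraph) : Prop :=
  exists f : G -> 'I_k, equitable_coloring f.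

(* Main.v *)
Require Import Defs.
From mathcomp Require Import all_boot.

(** A color lies in at most [#|G|] lists, so by monotonicity of [ceil_div] a proportional coloring
    is already equitable ([proportional_equitable]). For colorability, give every vertex the same
    list, all of ['I_k]: each multiplicity is then [#|G|], so every class size is the floor or the
    ceiling of [#|G| / k], and two such sizes differ by at most one ([proportional_full_lists]). *)

Lemma leq_ceil_div (d m n : nat) : m <= n -> ceil_div m d <= ceil_div n d.
Proof.
move=> le_mn; rewrite /ceil_div.
have := leq_div2r d le_mn; rewrite leq_eqVlt => /orP[/eqP eq_q | lt_q].
  rewrite eq_q leq_add2l; have [dvd_n | _] := boolP (d %| n); last exact: leq_b1.
  (* With equal quotients, a multiple [n] of [d] is the least number with that quotient, which
     forces [m = n]. *)
  have le_nm : n <= m by rewrite -(divnK dvd_n) -eq_q leq_divM.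
  by have /eqP-> : m == n; rewrite ?dvd_n // eqn_leq le_mn.
(* A strictly larger quotient absorbs the rounding bit of [m]. *)
by apply: leq_trans (leq_addr _ _); apply: leq_trans lt_q; rewrite -addn1 leq_add2l leq_b1.
Qed.

Lemma ceil_div_bounds (m d : nat) : m %/ d <= ceil_div m d <= m %/ d + 1.
Proof. by rewrite leq_addr leq_add2l leq_b1. Qed.

Lemma proportional_class_bounds (k : nat) (G : sgraph) (C : finType)
    (L : G -> {set C}) (f : G -> C) (c : C) :
    proportional_L_coloring k L f -> c \in palette L ->
  eta_mult L c %/ k <= #|color_class f c| <= ceil_div (eta_mult L c) k.
Proof.
have /andP[le_fc _] := ceil_div_bounds (eta_mult L c) k.
by move=> [_ Hf] /Hf [] ->; rewrite leqnn le_fc.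
Qed.

Lemma proportional_equitable (k : nat) (G : sgraph) (C : finType)
    (L : G -> {set C}) (f : G -> C) :
  proportional_L_coloring k L f -> equitable_L_coloring k L f.
Proof.
move=> f_prop; have [[f_proper fL] _] := f_prop; split=> [//|c].
(* Proportionality says nothing about colors outside the palette, but a nonempty class puts its
   color in some list. *)
have [-> | [v]] := set_0Vmem (color_class f c); first by rewrite cards0.
rewrite inE => /eqP fv.
have c_pal : c \in palette L by apply/bigcupP; exists v; rewrite // -fv fL.
have /andP[_ le_c] := proportional_class_bounds _ _ _ _ _ _ f_prop c_pal.
by apply: leq_trans le_c (leq_ceil_div _ _ _ _); apply: max_card.
Qed.

Lemma proportional_full_lists (k : nat) (G : sgraph) (f : G -> 'I_k) :
  proportional_L_coloring k (fun=> setT) f -> equitable_coloring f.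
Proof.
move=> f_prop; have [[f_proper _] _] := f_prop; split=> // i j.
(* The lists being full, a single vertex [v] puts every color in the palette, including [j], whose
   class may be empty; without vertices the palette would be empty. *)
have [-> | [v _]] := set_0Vmem (color_class f i); first by rewrite cards0.
have bounds c : #|G| %/ k <= #|color_class f c| <= ceil_div #|G| k.
  have <- : eta_mult (fun _ : G => [set: 'I_k]) c = #|G|.
    by rewrite -cardsT; congr #|pred_of_set _|; apply/setP=> u; rewrite !inE.
  by apply: proportional_class_bounds f_prop _; apply/bigcupP; exists v; rewrite ?inE.
have /andP[_ le_i] := bounds i; have /andP[le_j _] := bounds j.
have /andP[_ le_ceil] := ceil_div_bounds #|G| k.
by apply: leq_trans le_i (leq_trans le_ceil _); rewrite leq_add2r.
Qed.

Theorem proposition5 (k : nat) (G : sgraph) (k_gt0 : 0 < k)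
    (G_prop : proportionally_choosable k G) :
  equitably_choosable k G /\ equitably_colorable k G.
Proof.
split=> [C L /G_prop [f f_prop]|].
  by exists f; apply: proportional_equitable.
have [|f f_prop] := G_prop 'I_k (fun=> setT).
  by move=> v; rewrite cardsT card_ord.
by exists f; apply: proportional_full_lists.
Qed.
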